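(* Consider the measurement model $\mathbf{y}=\mathbf{g}(\mathbf{L},\mathbf{x})+\mathbf{w}$ described in the context, with $\mathbf{C}_{\mathbf{y}\mathbf{y}}$ and $\mathbf{D}_{\tilde{\mathbf{y}}\tilde{\mathbf{y}}}$ non-singular. Suppose that: (C.3) the noise is uncorrelated in the graph frequency domain, i.e. $\mathbf{C}_{\tilde{\mathbf{w}}\tilde{\mathbf{w}}}$ is a diagonal matrix, where $\tilde{\mathbf{w}}=\mathbf{V}^T\mathbf{w}$; (C.4) the measurement function is the output of a linear graph filter, i.e. $$\mathbf{g}(\mathbf{L},\mathbf{x})=\mathbf{V}f(\boldsymbol{\Lambda})\mathbf{V}^T\mathbf{x},$$ where $f(\boldsymbol{\Lambda})$ is the real diagonal matrix with diagonal entries $f(\lambda_1),\dots,f(\lambda_N)$ for a function $f$ well defined on the spectrum $\{\lambda_1,\dots,\lambda_N\}$ of $\mathbf{L}$; (C.5) the covariance matrix $\mathbf{C}_{\mathbf{x}\mathbf{x}}$ of the input graph signal is diagonalizable by the eigenvector matrix $\mathbf{V}$ of the Laplacian, i.e. $\mathbf{C}_{\tilde{\mathbf{x}}\tilde{\mathbf{x}}}$ is a diagonal matrix, where $\tilde{\mathbf{x}}=\mathbf{V}^T\mathbf{x}$. Then the GSP-LMMSE estimator coincides with the LMMSE estimator, i.e. $\hat{\mathbf{x}}^{(\mathrm{GSP\text{-}LMMSE})}=\hat{\mathbf{x}}^{(\mathrm{LMMSE})}$ as functions of $\mathbf{y}$.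
   Context: Graph: $\mathcal{G}$ is an undirected connected weighted graph on $N$ vertices with symmetric non-negative weighted adjacency matrix $\mathbf{W}\in\mathbb{R}^{N\times N}$ and Laplacian $\mathbf{L}=\mathrm{diag}(\mathbf{W}\mathbf{1})-\mathbf{W}$. Its eigenvalue decomposition is $\mathbf{L}=\mathbf{V}\boldsymbol{\Lambda}\mathbf{V}^T$, where $\boldsymbol{\Lambda}$ is diagonal with $0=\lambda_1<\lambda_2\le\dots\le\lambda_N$ and $\mathbf{V}$ is orthogonal ($\mathbf{V}^T=\mathbf{V}^{-1}$). The graph Fourier transform (GFT) of $\mathbf{a}\in\mathbb{R}^N$ is $\tilde{\mathbf{a}}=\mathbf{V}^T\mathbf{a}$. Model: $\mathbf{y}=\mathbf{g}(\mathbf{L},\mathbf{x})+\mathbf{w}$, where $\mathbf{g}:\mathbb{R}^{N\times N}\times\mathbb{R}^N\to\mathbb{R}^N$ is a known function, $\mathbf{x}$ is a random vector in $\mathbb{R}^N$, and $\mathbf{w}$ is a zero-mean random noise vector in $\mathbb{R}^N$ independent of $\mathbf{x}$; $\mathbf{x}$ and $\mathbf{w}$ have finite second moments. Notation: $\mathbf{C}_{\mathbf{a}\mathbf{b}}=\mathbb{E}[(\mathbf{a}-\mathbb{E}[\mathbf{a}])(\mathbf{b}-\mathbb{E}[\mathbf{b}])^T]$. For a vector $\mathbf{a}$, $\mathrm{diag}(\mathbf{a})$ is the diagonal matrix with diagonal $\mathbf{a}$; for a matrix $\mathbf{A}$, $\mathrm{diag}(\mathbf{A})$ is the vector of its diagonal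 entries. Put $\mathbf{d}_{\tilde{\mathbf{x}}\tilde{\mathbf{y}}}=\mathrm{diag}(\mathbf{C}_{\tilde{\mathbf{x}}\tilde{\mathbf{y}}})$ and $\mathbf{D}_{\tilde{\mathbf{y}}\tilde{\mathbf{y}}}=\mathrm{diag}(\mathrm{diag}(\mathbf{C}_{\tilde{\mathbf{y}}\tilde{\mathbf{y}}}))$. Estimators: the LMMSE estimator minimizes $\mathbb{E}\|\hat{\mathbf{x}}-\mathbf{x}\|^2$ among affine functions of $\mathbf{y}$; when $\mathbf{C}_{\mathbf{y}\mathbf{y}}$ is non-singular it is $$\hat{\mathbf{x}}^{(\mathrm{LMMSE})}=\mathbb{E}[\mathbf{x}]+\mathbf{C}_{\mathbf{x}\mathbf{y}}\mathbf{C}_{\mathbf{y}\mathbf{y}}^{-1}(\mathbf{y}-\mathbb{E}[\mathbf{y}]).$$ The GSP-LMMSE estimator minimizes $\mathbb{E}\|\hat{\mathbf{x}}-\mathbf{x}\|^2$ among estimators $\hat{\mathbf{x}}=\mathbf{V}\mathbf{F}\mathbf{V}^T\mathbf{y}+\mathbf{b}$ with $\mathbf{F}$ a real diagonal $N\times N$ matrix and $\mathbf{b}\in\mathbb{R}^N$; when $\mathbf{D}_{\tilde{\mathbf{y}}\tilde{\mathbf{y}}}$ is non-singular it is $$\hat{\mathbf{x}}^{(\mathrm{GSP\text{-}LMMSE})}=\mathbb{E}[\mathbf{x}]+\mathbf{V}\,\mathrm{diag}(\mathbf{d}_{\tilde{\mathbf{x}}\tilde{\mathbf{y}}})\,\mathbf{D}_{\tilde{\mathbf{y}}\tilde{\mathbf{y}}}^{-1}\mathbf{V}^T(\mathbf{y}-\mathbb{E}[\mathbf{y}]).$$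 *)

(* Defs.v *)
From mathcomp Require Export all_boot all_order all_algebra.
From mathcomp Require Export all_classical all_reals all_analysis.
Export Order.TTheory GRing.Theory Num.Theory.
Export numFieldNormedType.Exports.

Set Implicit Arguments.
Unset Strict Implicit.
Unset Printing Implicit Defensive.

Local Open Scope classical_set_scope.
Local Open Scope ring_scope.

Section Graph.
Context {R : realType} {N : nat}.
Implicit Types (W L V : 'M[R]_N).

(* Diagonal entries of W (self-loops) are not excluded; they cancel in the
   Laplacian. *)
Definition connected_weighted_graph W : Prop :=
  [/\ (0 < N)%N, W^T = W, (forall i j, 0 <= W i j)
    & forall i j, connect (fun k l => 0 < W k l) i j].

Definition laplacian W : 'M[R]_N :=
  diag_mx (W *m (const_mx 1 : 'cV[R]_N))^T - W.

(* Indices start from 0, so the smallest eigenvalue is the one at index 0. *)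
Definition laplacian_evd L V (lam : 'rV[R]_N) : Prop :=
  [/\ L = V *m diag_mx lam *m V^T,
      V^T *m V = 1%:M,
      (forall i : 'I_N, i = 0%N :> nat -> lam 0 i = 0),
      (forall i : 'I_N, (0 < i)%N -> 0 < lam 0 i)
    & forall i j : 'I_N, (i <= j)%N -> lam 0 i <= lam 0 j].

Definition gft V (a : 'cV[R]_N) : 'cV[R]_N := V^T *m a.

Definition diag_entries (A : 'M[R]_N) : 'rV[R]_N := \row_i A i i.

End Graph.

Section RandomVectors.
Context {d : measure_display} {T : measurableType d} {R : realType}.
Variables (P : probability T R) (N : nat).
Implicit Types a b : T -> 'cV[R]_N.

Definition coord a (i : 'I_N) : T -> R := fun t => a t i 0.

(* [Lfun] includes the measurability of the coordinates. *)
Definition finite_second_moment a : Prop :=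
  forall i, coord a i \in Lfun P 2%:E.

Definition mean a : 'cV[R]_N := \col_i fine 'E_P[coord a i].

Definition cov a b : 'M[R]_N :=
  \matrix_(i, j) fine (covariance P (coord a i) (coord b j)).

(* Independence of the sigma-algebras generated by the two vectors. *)
Definition independent_vectors a b : Prop :=
  forall A B : set T,
    g_sigma_preimage (coord a) A -> g_sigma_preimage (coord b) B ->
    P (A `&` B) = (P A * P B)%E.

End RandomVectors.

Section Estimators.
Context {d : measure_display} {T : measurableType d} {R : realType}.
Variables (P : probability T R) (N : nat).
Variable V : 'M[R]_N.
Variables x y : T -> 'cV[R]_N.
Implicit Type h : 'cV[R]_N -> 'cV[R]_N.

Definition mse h : \bar R :=
  'E_P[fun t => \sum_(i < N) ((h (y t) - x t) i 0) ^+ 2].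

Definition affine_estimator h : Prop :=
  exists (A : 'M[R]_N) (b : 'cV[R]_N), h = fun z => A *m z + b.

Definition gsp_estimator h : Prop :=
  exists (F : 'M[R]_N) (b : 'cV[R]_N),
    is_diag_mx F /\ h = fun z => V *m F *m V^T *m z + b.

Definition mse_minimizer (C : ('cV[R]_N -> 'cV[R]_N) -> Prop) h : Prop :=
  C h /\ forall h', C h' -> (mse h <= mse h')%E.

Definition is_lmmse h : Prop := mse_minimizer affine_estimator h.
Definition is_gsp_lmmse h : Prop := mse_minimizer gsp_estimator h.

Definition lmmse : 'cV[R]_N -> 'cV[R]_N := fun z =>
  mean P x + cov P x y *m invmx (cov P y y) *m (z - mean P y).

Definition d_xy : 'rV[R]_N :=
  diag_entries (cov P (gft V \o x) (gft V \o y)).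

Definition D_yy : 'M[R]_N :=
  diag_mx (diag_entries (cov P (gft V \o y) (gft V \o y))).

Definition gsp_lmmse : 'cV[R]_N -> 'cV[R]_N := fun z =>
  mean P x + V *m diag_mx d_xy *m invmx D_yy *m V^T *m (z - mean P y).

End Estimators.

(* Main.v *)
(** Adding an affine perturbation [u = B y + v] to the LMMSE estimator adds
    [tr (cov u u) + |E u|^2] to its mean squared error, because the LMMSE error
    has mean zero and is uncorrelated with [y].  Since [cov y y] is invertible,
    this vanishes only for [B = 0] and [v = 0], so that the LMMSE estimator is
    the unique minimizer in any class of affine estimators that contains it.
    Under (C.3)-(C.5), [cov x y] and [cov y y] are simultaneously diagonalized
    by [V], as independence kills [cov x w]; this turns the LMMSE formula into
    the GSP-LMMSE one, and in particular puts it in the GSP class. *)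

Require Import Defs.
From mathcomp Require Import measurable_realfun.
Local Open Scope ring_scope.

(** * Expectation and covariance of square-integrable random variables *)

Section L2.
Set Implicit Arguments.
Unset Strict Implicit.
Local Open Scope classical_set_scope.
Local Open Scope ring_scope.
Context {d : measure_display} {T : measurableType d} {R : realType}.
Variable P : probability T R.
Implicit Types X Y Z : T -> R.

Lemma Lfun2_Lfun1 X : X \in Lfun P 2%:E -> X \in Lfun P 1.
Proof. by apply: Lfun_subset12; rewrite fin_num_measure. Qed.

Lemma Lfun2_sum I (r : seq I) (X : I -> T -> R) :
  (forall i, X i \in Lfun P 2%:E) ->
  (fun t => \sum_(i <- r) X i t) \in Lfun P 2%:E.
Proof.
move=> X2; elim: r => [|i r IHr].
  by under eq_fun do rewrite big_nil; exact: (Lfun_cst P 0 2).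
by under eq_fun do rewrite big_cons; apply: rpredD; rewrite ?lee1n.
Qed.

Lemma covariance_suml I (r : seq I) (X : I -> T -> R) Y :
  (forall i, X i \in Lfun P 2%:E) -> Y \in Lfun P 2%:E ->
  covariance P (fun t => \sum_(i <- r) X i t) Y
  = (\sum_(i <- r) covariance P (X i) Y)%E.
Proof.
move=> X2 Y2; elim: r => [|i r IHr].
  under [X in covariance _ X]eq_fun do rewrite big_nil.
  by rewrite big_nil (covariance_cst_l P 0).
under [X in covariance _ X]eq_fun do rewrite big_cons.
rewrite big_cons -IHr; apply: (@covarianceDl _ _ _ _ (X i)) => //.
exact: Lfun2_sum.
Qed.

Lemma covariance_fin_num2 X Y :
  X \in Lfun P 2%:E -> Y \in Lfun P 2%:E -> covariance P X Y \is a fin_num.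
Proof.
move=> X2 Y2; apply: covariance_fin_num; try exact: Lfun2_Lfun1.
exact: Lfun2_mul_Lfun1.
Qed.

Lemma expectation_suml I (r : seq I) (X : I -> T -> R) :
  (forall i, X i \in Lfun P 1) ->
  expectation P (fun t => \sum_(i <- r) X i t) = (\sum_(i <- r) 'E_P[X i])%E.
Proof.
(* The induction also carries integrability of the partial sum, which additivity of the expectation
   requires at each step. *)
move=> X1; suff [] : (fun t => \sum_(i <- r) X i t) \in Lfun P 1 /\
    expectation P (fun t => \sum_(i <- r) X i t) =
    (\sum_(i <- r) 'E_P[X i])%E by [].
elim: r => [|i r [S1 IHr]].
  by under eq_fun do rewrite big_nil; rewrite big_nil (Lfun_cst P 0 1)
     (expectation_cst P 0).
under eq_fun do rewrite big_cons.
rewrite big_cons -IHr; split; last exact: (@expectationD _ _ _ _ (X i)).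
by apply: (@rpredD _ _ (X i)).
Qed.

Lemma expectation_sqr X : X \in Lfun P 2%:E ->
  expectation P (fun t => X t ^+ 2)
  = (fine (covariance P X X) + fine 'E_P[X] ^+ 2)%:E.
Proof.
move=> X2; have := varianceE X2; rewrite /variance => VX.
have E2 : 'E_P[X ^+ 2]%E \is a fin_num.
  exact/expectation_fin_num/(Lfun2_mul_Lfun1 X2 X2).
have E1 : 'E_P[X]%E \is a fin_num by rewrite expectation_fin_num// Lfun2_Lfun1.
rewrite EFinD fineK ?covariance_fin_num2// VX EFin_expe fineK//.
by rewrite subeK// fin_numX.
Qed.

(** By Cauchy-Schwarz, a variable of zero variance has covariance at most 0 with any
    square-integrable variable; [Y] and its opposite give the two inequalities. *)
Lemma covariance_eq0 X Y : X \in Lfun P 2%:E -> Y \in Lfun P 2%:E ->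
  covariance P X X = 0%E -> covariance P X Y = 0%E.
Proof.
move=> X2 Y2 X0.
have le0 Z : Z \in Lfun P 2%:E -> (covariance P X Z <= 0)%E.
  by move=> Z2; rewrite (le_trans (covariance_le X2 Z2))// /variance X0
    sqrte0 mul0e.
apply/le_anti; rewrite le0//=; have := le0 (\- Y)%R.
rewrite covarianceNr ?Lfun2_mul_Lfun1 ?Lfun2_Lfun1// oppe_le0; apply.
by rewrite rpredN// lee1n.
Qed.

(** Independence makes the law of the pair agree with the product of the marginal laws on
    rectangles, hence on all measurable sets by uniqueness of the product measure. Fubini then gives
    the iterated integral. *)
Lemma integral_indep d1 d2 (T1 : measurableType d1) (T2 : measurableType d2)
    (X : {mfun T >-> T1}) (Y : {mfun T >-> T2}) (f : T1 * T2 -> \bar R) :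
  (forall A B, measurable A -> measurable B ->
    P (X @^-1` A `&` Y @^-1` B) = (P (X @^-1` A) * P (Y @^-1` B))%E) ->
  measurable_fun setT f ->
  P.-integrable setT (fun t => f (X t, Y t)) ->
  (\int[P]_t f (X t, Y t) =
   \int[distribution P X]_x \int[distribution P Y]_y f (x, y))%E.
Proof.
move=> XY mf If.
have mXY : measurable_fun setT (fun t => (X t, Y t)).
  exact: measurable_fun_pair.
pose Z := mfun_Sub (mem_set mXY).
pose m1 : probability _ R := distribution P X.
pose m2 : probability _ R := distribution P Y.
pose m : probability _ R := distribution P Z.
have prodE A : measurable A -> (m1 \x m2)%E A = m A.
  by apply: product_measure_unique => B C mB mC; exact: XY.
have Ifm : (m1 \x m2)%E.-integrable setT f.
  have /integrableP[_ oo] : m.-integrable setT f.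
    exact: integrable_pushforward.
  apply/integrableP; split => //; rewrite (eq_measure_integral m)//.
  by move=> A mA _; exact: prodE.
rewrite -[LHS](integral_distribution (X := Z) mf If).
rewrite -(eq_measure_integral m (m1 := (m1 \x m2)%E)); last first.
  by move=> A mA _; exact: prodE.
by rewrite -integral12_prod_meas1.
Qed.

(** The product of two square-integrable variables is integrable, so the previous lemma applies to
    it and factors its expectation. *)
Lemma covariance_indep X Y : X \in Lfun P 2%:E -> Y \in Lfun P 2%:E ->
  (forall A B : set R, measurable A -> measurable B ->
    P (X @^-1` A `&` Y @^-1` B) = (P (X @^-1` A) * P (Y @^-1` B))%E) ->
  covariance P X Y = 0%E.
Proof.
move=> X2 Y2 XY.
have X1 := Lfun2_Lfun1 X2; have Y1 := Lfun2_Lfun1 Y2.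
have XY1 := Lfun2_mul_Lfun1 X2 Y2.
rewrite covarianceE//.
have fX : 'E_P[X]%E \is a fin_num by rewrite expectation_fin_num.
have fY : 'E_P[Y]%E \is a fin_num by rewrite expectation_fin_num.
suff -> : ('E_P[X * Y] = 'E_P[X] * 'E_P[Y])%E by rewrite subee// fin_numM.
have /andP[mX _] := X1; have /andP[mY _] := Y1.
pose X' := mfun_Sub mX; pose Y' := mfun_Sub mY.
have fY' := fY; rewrite unlock in fY'.
pose f (z : R * R) := (z.1 * z.2)%:E.
rewrite unlock [LHS](@integral_indep _ _ _ _ X' Y' f)//; last 2 first.
- exact/measurable_EFinP/measurable_funM.
- exact/Lfun1_integrable.
have IZ (Z : {mfun T >-> R}) : (Z : T -> R) \in Lfun P 1 ->
    (distribution P Z).-integrable setT (@EFin R).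
  move=> Z1; apply: integrable_pushforward; rewrite ?preimage_setT//.
  exact/Lfun1_integrable.
(* The inner integral is [x] times the expectation of [Y], put in the form of a real number so that
   it can be pulled out of the outer integral. *)
under eq_integral => x _.
  under eq_integral do rewrite /f /= EFinM.
  rewrite integralZl ?IZ// (integral_distribution (X := Y')) //=; last first.
    exact/Lfun1_integrable.
  rewrite -(fineK fY').
  over.
rewrite /= integralZr ?IZ// (integral_distribution (X := X'))//=.
  by rewrite fineK.
exact/Lfun1_integrable.
Qed.

End L2.

(** * Calculus of means and covariance matrices of random vectors *)

Section random_vectors.
Set Implicit Arguments.
Unset Strict Implicit.
Local Open Scope classical_set_scope.
Local Open Scope ring_scope.
Context {d : measure_display} {T : measurableType d} {R : realType}.
Variables (P : probability T R) (N : nat).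
Implicit Types (a b c : T -> 'cV[R]_N) (A B : 'M[R]_N) (v : 'cV[R]_N).
Local Notation L2 := (finite_second_moment P).

(** The summands are written with [\o*] to match the scaling rules for [Lfun], expectation and
    covariance. *)
Let coord_mulmx A a i :
  coord (fun t => A *m a t) i = fun t => \sum_k (A i k \o* coord a k)%R t.
Proof.
by apply/funext => t; rewrite /coord mxE; apply: eq_bigr => k _; rewrite mulrC.
Qed.

Let coord_add a b i :
  coord (fun t => a t + b t) i = (coord a i \+ coord b i)%R.
Proof. by apply/funext => t; rewrite /coord mxE. Qed.

Lemma finite_second_moment_mulmx A a : L2 a -> L2 (fun t => A *m a t).
Proof.
move=> a2 i; rewrite coord_mulmx; apply: Lfun2_sum => k.
by apply: Lfun_scale; rewrite ?ler1n.
Qed.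

Lemma finite_second_moment_add a b : L2 a -> L2 b -> L2 (fun t => a t + b t).
Proof.
by move=> a2 b2 i; rewrite coord_add; apply: rpredD; rewrite ?lee1n.
Qed.

Lemma finite_second_moment_cst v : L2 (fun=> v).
Proof. by move=> i; exact: (Lfun_cst P (v i 0) 2). Qed.

Lemma cov_tr a b : cov P b a = (cov P a b)^T.
Proof. by apply/matrixP => i j; rewrite !mxE covarianceC. Qed.

Lemma cov_mulmxl A a b : L2 a -> L2 b ->
  cov P (fun t => A *m a t) b = A *m cov P a b.
Proof.
move=> a2 b2; apply/matrixP => i j; rewrite !mxE coord_mulmx.
have L1 k : (A i k \o* coord a k)%R \in Lfun P 2%:E.
  by apply: Lfun_scale; rewrite ?ler1n.
rewrite covariance_suml// -sum_fine; last first.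
  by move=> k _; exact: covariance_fin_num2.
apply: eq_bigr => k _; rewrite mxE covarianceZl ?fineM//.
- exact: covariance_fin_num2.
- exact: Lfun2_Lfun1.
- exact: Lfun2_Lfun1.
- exact: Lfun2_mul_Lfun1.
Qed.

Lemma cov_addl a b c : L2 a -> L2 b -> L2 c ->
  cov P (fun t => a t + b t) c = cov P a c + cov P b c.
Proof.
move=> a2 b2 c2; apply/matrixP => i j; rewrite !mxE coord_add.
by rewrite covarianceDl// fineD// covariance_fin_num2.
Qed.

Lemma cov_cstl v b : cov P (fun=> v) b = 0.
Proof.
by apply/matrixP => i j; rewrite !mxE (covariance_cst_l P (v i 0)).
Qed.

Lemma cov_mulmxr A a b : L2 a -> L2 b ->
  cov P b (fun t => A *m a t) = cov P b a *m A^T.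
Proof. by move=> a2 b2; rewrite cov_tr cov_mulmxl// trmx_mul -cov_tr. Qed.

Lemma cov_addr a b c : L2 a -> L2 b -> L2 c ->
  cov P c (fun t => a t + b t) = cov P c a + cov P c b.
Proof.
by move=> a2 b2 c2; rewrite cov_tr cov_addl// linearD/= -!cov_tr.
Qed.

Lemma cov_cstr v b : cov P b (fun=> v) = 0.
Proof. by rewrite cov_tr cov_cstl trmx0. Qed.

Lemma mean_mulmx A a : L2 a -> mean P (fun t => A *m a t) = A *m mean P a.
Proof.
move=> a2; apply/matrixP => i j; rewrite !mxE coord_mulmx.
have a1 k : coord a k \in Lfun P 1 by exact: Lfun2_Lfun1.
rewrite expectation_suml; last by move=> k; apply: Lfun_scale.
rewrite -sum_fine; last first.
  by move=> k _; apply: expectation_fin_num; apply: Lfun_scale.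
apply: eq_bigr => k _; rewrite mxE expectationZl ?fineM//.
exact: expectation_fin_num.
Qed.

Lemma mean_add a b : L2 a -> L2 b ->
  mean P (fun t => a t + b t) = mean P a + mean P b.
Proof.
move=> a2 b2; apply/matrixP => i j; rewrite !mxE coord_add.
have c1 k c : L2 c -> coord c k \in Lfun P 1 by move=> c2; exact: Lfun2_Lfun1.
by rewrite expectationD ?c1// fineD// expectation_fin_num// c1.
Qed.

Lemma mean_cst v : mean P (fun=> v) = v.
Proof.
apply/matrixP => i j; rewrite !mxE (expectation_cst P (v i 0))/=.
by rewrite [j]ord1.
Qed.

Lemma expectation_sqnorm a : L2 a ->
  expectation P (fun t => \sum_i a t i 0 ^+ 2)
  = (\tr (cov P a a) + \sum_i mean P a i 0 ^+ 2)%:E.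
Proof.
move=> a2; rewrite expectation_suml; last first.
  by move=> i; apply: (Lfun2_mul_Lfun1 (a2 i) (a2 i)).
rewrite /mxtrace -big_split -sumEFin; apply: eq_bigr => i _.
by rewrite (expectation_sqr (a2 i)) !mxE.
Qed.

Lemma cov_diag_ge0 a i : 0 <= cov P a a i i.
Proof. by rewrite mxE fine_ge0// variance_ge0. Qed.

(** The trace is a sum of nonnegative variances, so each of them vanishes and the scalar result
    applies to each coordinate. *)
Lemma cov_eq0 a b : L2 a -> L2 b -> \tr (cov P a a) = 0 -> cov P a b = 0.
Proof.
move=> a2 b2 tr0; apply/matrixP => i j; rewrite !mxE covariance_eq0//.
have Vi : cov P a a i i = 0.
  by apply: (psumr_eq0P _ tr0) => // k _; exact: cov_diag_ge0.
rewrite mxE in Vi.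
(* [fine] also sends infinities to 0, so finiteness is needed to get back to the extended real
   covariance. *)
by rewrite -[LHS]fineK ?Vi// covariance_fin_num2.
Qed.

(** The preimage of a measurable set under one coordinate is a generator of the sigma-algebra of the
    vector, so independence passes to each pair of coordinates. *)
Lemma cov_indep a b : L2 a -> L2 b -> independent_vectors P a b ->
  cov P a b = 0.
Proof.
move=> a2 b2 ab; apply/matrixP => i j; rewrite !mxE covariance_indep//.
have sub c k (A : set R) : measurable A ->
    g_sigma_preimage (coord c) (coord c k @^-1` A).
  move=> mA; apply: sub_sigma_algebra.
  rewrite (bigD1 k)//=; left.
  by exists A => //; rewrite setTI.
by move=> A B mA mB; apply: ab; exact: sub.
Qed.

End random_vectors.

(** * Optimality and uniqueness of the LMMSE estimator *)

Section lmmse.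
Context {d : measure_display} {T : measurableType d} {R : realType}.
Variables (P : probability T R) (N : nat) (x y : T -> 'cV[R]_N).
Hypotheses (x2 : finite_second_moment P x) (y2 : finite_second_moment P y).
Hypothesis Cyy_unit : cov P y y \in unitmx.

Local Notation K := (cov P x y *m invmx (cov P y y)).
Local Notation L2 := (finite_second_moment P).

Lemma lmmse_affine : affine_estimator (lmmse P x y).
Proof.
exists K, (mean P x - K *m mean P y); apply/funext => z.
by rewrite /lmmse mulmxBr addrCA.
Qed.

Let e t := lmmse P x y (y t) - x t.

(** Subtraction is expressed as multiplication by [- 1%:M], so that the rules for [*m] and sums
    suffice. *)
Let eE : e = fun t => (K *m y t + (mean P x - K *m mean P y)) + - 1%:M *m x t.
Proof.
apply/funext => t; rewrite /e /lmmse mulmxBr addrCA.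
by rewrite mulNmx mul1mx.
Qed.

Let Ky2 : L2 (fun t => K *m y t). Proof. exact: finite_second_moment_mulmx. Qed.

Let Kyc2 : L2 (fun t => K *m y t + (mean P x - K *m mean P y)).
Proof.
by apply: finite_second_moment_add => //; exact: finite_second_moment_cst.
Qed.

Let Nx2 : L2 (fun t => - 1%:M *m x t).
Proof. exact: finite_second_moment_mulmx. Qed.

Let e2 : L2 e. Proof. by rewrite eE; exact: finite_second_moment_add. Qed.

Let mean_e : mean P e = 0.
Proof.
rewrite eE mean_add// mean_add//; last exact: finite_second_moment_cst.
by rewrite !mean_mulmx// mean_cst mulNmx mul1mx addrCA subrr addr0 subrr.
Qed.

(** Orthogonality principle: the gain [K] solves the normal equation
    [K *m cov P y y = cov P x y]. *)
Let cov_e_y : cov P e y = 0.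
Proof.
rewrite eE cov_addl// cov_addl//; last exact: finite_second_moment_cst.
by rewrite !cov_mulmxl// cov_cstl addr0 mulNmx mul1mx mulmxKV// subrr.
Qed.

Let mse_lmmse : mse P x y (lmmse P x y) = (\tr (cov P e e))%:E.
Proof.
rewrite [LHS]expectation_sqnorm// mean_e big1 ?addr0// => i _.
by rewrite mxE expr0n.
Qed.

(** The LMMSE estimator is affine, so its difference with any affine competitor is again affine. *)
Lemma affine_estimator_lmmse h : affine_estimator h ->
  exists (B : 'M[R]_N) (v : 'cV[R]_N),
    h = fun z => lmmse P x y z + (B *m z + v).
Proof.
move=> [A [b ->]]; exists (A - K), (b - (mean P x - K *m mean P y)).
apply/funext => z; rewrite /lmmse mulmxBr mulmxBl.
rewrite [mean P x + _]addrCA addrACA [K *m z + _]addrC subrK.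
by rewrite [_ + (b - _)]addrC subrK.
Qed.

Section perturbation.
Variables (B : 'M[R]_N) (v : 'cV[R]_N).
Let u t := B *m y t + v.

Let By2 : L2 (fun t => B *m y t). Proof. exact: finite_second_moment_mulmx. Qed.

Let u2 : L2 u.
Proof.
by apply: finite_second_moment_add => //; exact: finite_second_moment_cst.
Qed.

(* The error of the LMMSE estimator is orthogonal to every affine function
   of [y]. *)
Lemma mse_lmmse_add :
  mse P x y (fun z => lmmse P x y z + (B *m z + v)) =
  (mse P x y (lmmse P x y) +
   (\tr (cov P u u) + \sum_i mean P u i 0 ^+ 2)%:E)%E.
Proof.
have v2 : L2 (fun=> v) by exact: finite_second_moment_cst.
have cov_e_u : cov P e u = 0.
  by rewrite cov_addr// cov_mulmxr// cov_e_y mul0mx cov_cstr addr0.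
have -> : mse P x y (fun z => lmmse P x y z + (B *m z + v)) =
    expectation P (fun t => \sum_i (e t + u t) i 0 ^+ 2).
  by congr expectation; apply/funext => t; rewrite /e /u addrAC.
have eu2 : L2 (fun t => e t + u t) by exact: finite_second_moment_add.
rewrite expectation_sqnorm// mse_lmmse mean_add// mean_e add0r.
rewrite (cov_addl e2 u2 eu2) (cov_addr e2 u2 e2) (cov_addr e2 u2 u2) cov_e_u.
by rewrite [cov P u e]cov_tr cov_e_u trmx0 add0r addr0 mxtraceD -EFinD addrA.
Qed.

Let tr_u_ge0 : 0 <= \tr (cov P u u).
Proof. by apply: sumr_ge0 => i _; exact: cov_diag_ge0. Qed.

Let mean_u_ge0 : 0 <= \sum_i mean P u i 0 ^+ 2.
Proof. by apply: sumr_ge0 => i _; exact: sqr_ge0. Qed.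

Lemma mse_lmmse_add_ge :
  (mse P x y (lmmse P x y) <=
   mse P x y (fun z => lmmse P x y z + (B *m z + v))%R)%E.
Proof. by rewrite mse_lmmse_add leeDl// lee_fin addr_ge0. Qed.

Lemma mse_lmmse_add_le :
  (mse P x y (fun z => lmmse P x y z + (B *m z + v))%R <=
   mse P x y (lmmse P x y))%E -> B = 0 /\ v = 0.
Proof.
(* The optimal error is a real number, so it can be cancelled from both sides. *)
rewrite mse_lmmse_add mse_lmmse -EFinD lee_fin gerDl => le0.
have /andP[/eqP tr0 /eqP mean0] :
    (\tr (cov P u u) == 0) && (\sum_i mean P u i 0 ^+ 2 == 0).
  by rewrite -paddr_eq0// eq_le le0 addr_ge0.
(* Zero total variance of [u] makes it uncorrelated with [y], that is [B *m cov P y y = 0], and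
   [cov P y y] is invertible. *)
have B0 : B = 0.
  have := cov_eq0 u2 y2 tr0; rewrite cov_addl//; last first.
    exact: finite_second_moment_cst.
  rewrite cov_mulmxl// cov_cstl addr0.
  by move=> /(congr1 (mulmx^~ (invmx (cov P y y)))); rewrite mulmxK// mul0mx.
split=> //; have <- : mean P u = v.
  by rewrite /u B0; under eq_fun do rewrite mul0mx add0r; exact: mean_cst.
apply/matrixP => i j; rewrite [j]ord1 [RHS]mxE; apply/eqP; rewrite -sqrf_eq0.
apply/eqP; apply: (psumr_eq0P _ mean0) => // k _; exact: sqr_ge0.
Qed.

End perturbation.

Lemma is_lmmse_lmmse : is_lmmse P x y (lmmse P x y).
Proof.
split; first exact: lmmse_affine.
by move=> _ /affine_estimator_lmmse[B [v ->]]; exact: mse_lmmse_add_ge.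
Qed.

Lemma mse_le_lmmse h : affine_estimator h ->
  (mse P x y h <= mse P x y (lmmse P x y))%E -> h = lmmse P x y.
Proof.
move=> /affine_estimator_lmmse[B [v ->]] /mse_lmmse_add_le[-> ->].
by apply/funext => z; rewrite mul0mx !addr0.
Qed.

(** Keeping the class [C] abstract lets one statement serve both the affine and the GSP
    estimators. *)
Lemma mse_minimizer_lmmse (C : ('cV[R]_N -> 'cV[R]_N) -> Prop) :
  (forall h, C h -> affine_estimator h) -> C (lmmse P x y) ->
  forall h, mse_minimizer P x y C h <-> h = lmmse P x y.
Proof.
move=> Caff C_lmmse h; split=> [[Ch hmin]|->].
  by apply: mse_le_lmmse; [exact: Caff|exact: hmin].
by split=> // h' /Caff; exact: is_lmmse_lmmse.2.
Qed.

End lmmse.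

(** * Diagonal matrices *)

Lemma diag_mxE_diag_entries (R : realType) n (A : 'M[R]_n) :
  is_diag_mx A -> diag_mx (diag_entries A) = A.
Proof.
move=> /diag_mxP[a ->]; congr diag_mx; apply/rowP => i.
by rewrite !mxE eqxx mulr1n.
Qed.

Lemma is_diag_mxM (R : realType) n (A B : 'M[R]_n) :
  is_diag_mx A -> is_diag_mx B -> is_diag_mx (A *m B).
Proof.
by move=> /diag_mxP[a ->] /diag_mxP[b ->]; rewrite mulmx_diag diag_mx_is_diag.
Qed.

Lemma is_diag_mxD (R : realType) n (A B : 'M[R]_n) :
  is_diag_mx A -> is_diag_mx B -> is_diag_mx (A + B).
Proof.
by move=> /diag_mxP[a ->] /diag_mxP[b ->]; rewrite -linearD diag_mx_is_diag.
Qed.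

Lemma is_diag_invmx (R : realType) n (A : 'M[R]_n) :
  is_diag_mx A -> is_diag_mx (invmx A).
Proof.
(* By convention [invmx A] is [A] itself when [A] is singular. *)
have [Au|/invmx_out ->//] := boolP (A \in unitmx).
move=> /diag_mxP[a aE]; have := mulVmx Au; have := Au.
rewrite {1 3}aE mul_mx_diag => _ /matrixP E; apply/is_diag_mxP => i j ij.
(* Entry [(i, j)] of [invmx A *m A] is that of [invmx A] times [a 0 j]. Off the diagonal the product
   is 0, and [a 0 j = 0] would make the diagonal entry [(j, j)] vanish instead of being 1. *)
have /eqP := E i j; rewrite !mxE -val_eqE (negPf ij) mulf_eq0.
move=> /orP[/eqP//|a0].
by have /eqP := E j j; rewrite !mxE (eqP a0) mulr0 eqxx eq_sym oner_eq0.
Qed.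

(** * Coincidence of the two estimators *)

Theorem theorem3 (R : realType) (d : measure_display) (T : measurableType d)
    (P : probability T R) (N : nat)
    (W V : 'M[R]_N) (lam : 'rV[R]_N)
    (g : 'M[R]_N -> 'cV[R]_N -> 'cV[R]_N)
    (x w y : T -> 'cV[R]_N) (f : R -> R)
    (hW : connected_weighted_graph W)
    (hV : laplacian_evd (laplacian W) V lam)
    (hx : finite_second_moment P x)
    (hw : finite_second_moment P w)
    (hw0 : mean P w = 0)
    (hxw : independent_vectors P x w)
    (hy : forall t, y t = g (laplacian W) (x t) + w t)
    (hCyy : cov P y y \in unitmx)
    (hDyy : D_yy P V y \in unitmx)
    (C3 : is_diag_mx (cov P (gft V \o w) (gft V \o w)))
    (C4 : forall z, g (laplacian W) z =
            V *m diag_mx (map_mx f lam) *m V^T *m z)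
    (C5 : is_diag_mx (cov P (gft V \o x) (gft V \o x))) :
  [/\ (forall h, is_lmmse P x y h <-> h = lmmse P x y),
      (forall h, is_gsp_lmmse P V x y h <-> h = gsp_lmmse P V x y)
    & gsp_lmmse P V x y = lmmse P x y].
Proof.

have [_ VtV _ _ _] := hV.
have VVt := mulmx1C VtV.
set Phi := diag_mx _ in C4.
have dPhi : is_diag_mx Phi by exact: diag_mx_is_diag.
have L2M (A : 'M[R]_N) a : finite_second_moment P a ->
    finite_second_moment P (fun t => A *m a t).
  exact: finite_second_moment_mulmx.
have yE : y = fun t => V *m Phi *m V^T *m x t + w t.
  by apply/funext => t; rewrite hy C4.
have hMx := L2M (V *m Phi *m V^T) _ hx.
have hyt : finite_second_moment P y.
  by rewrite yE; exact: finite_second_moment_add.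
have cxw := cov_indep hx hw hxw.
have covgft (a b : T -> 'cV[R]_N) :
    finite_second_moment P a -> finite_second_moment P b ->
    cov P (gft V \o a) (gft V \o b) = V^T *m cov P a b *m V.
  move=> a2 b2; rewrite [LHS](cov_mulmxl _ a2 (L2M _ _ b2)).
  by rewrite (cov_mulmxr _ b2 a2) trmxK mulmxA.
rewrite !covgft// in C3 C5.
set Dw := _ *m _ in C3; set Dx := _ *m _ in C5.
have Cw : cov P w w = V *m Dw *m V^T.
  by rewrite /Dw !mulmxA VVt mul1mx -mulmxA VVt mulmx1.
have Cx : cov P x x = V *m Dx *m V^T.
  by rewrite /Dx !mulmxA VVt mul1mx -mulmxA VVt mulmx1.
have PhiT : Phi^T = Phi by rewrite /Phi tr_diag_mx.
have VK p (A : 'M[R]_(N, p)) : V^T *m (V *m A) = A by rewrite mulmxA VtV mul1mx.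
have Cxy : cov P x y = V *m (Dx *m Phi) *m V^T.
  rewrite yE cov_addr// cxw addr0 cov_mulmxr// Cx !trmx_mul trmxK PhiT.
  by rewrite -!mulmxA VK.
(* Only the left [y] is expanded first, which exposes the known [cov P x y]; the remaining
   [cov P w y] reduces to [cov P w w]. *)
have Cyy : cov P y y = V *m (Phi *m (Dx *m Phi) + Dw) *m V^T.
  rewrite {1}yE cov_addl// cov_mulmxl// Cxy yE cov_addr// cov_mulmxr//.
  rewrite (cov_tr P x w) cxw trmx0 mul0mx add0r Cw.
  by rewrite mulmxDr mulmxDl -!mulmxA VK.
set D := _ + Dw in Cyy.
have dD : is_diag_mx D 
  by apply: is_diag_mxD C3; do 2![apply: is_diag_mxM => //].
have VKV (A : 'M[R]_N) : V^T *m (V *m A *m V^T) *m V = A.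
  by rewrite -!mulmxA VtV mulmx1 VK.
(* The covariance of the GFT of [y] is already diagonal, so keeping only its diagonal loses nothing;
   likewise for the cross-covariance below. *)
have DE : D_yy P V y = D.
  by rewrite /D_yy covgft// Cyy VKV diag_mxE_diag_entries.
have dE : diag_mx (d_xy P V x y) = Dx *m Phi.
  by rewrite /d_xy covgft// Cxy VKV diag_mxE_diag_entries//; exact: is_diag_mxM.
rewrite DE in hDyy.
have Cyy_inv : invmx (cov P y y) = V *m invmx D *m V^T.
  (* The candidate inverse is multiplied on the left by [invmx (cov P y y) *m cov P y y]; expanding
     the second factor cancels the candidate. *)
  rewrite -[RHS]mul1mx -(mulVmx hCyy) -mulmxA {3}Cyy -!mulmxA VK.
  by rewrite [D *m _]mulmxA mulmxV// mul1mx VVt mulmx1.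
have E : gsp_lmmse P V x y = lmmse P x y.
  apply/funext => z; rewrite /gsp_lmmse /lmmse DE dE Cxy Cyy_inv.
  by rewrite -!mulmxA VK.
split=> //.
- by apply: mse_minimizer_lmmse => //; exact: lmmse_affine.
- rewrite E; apply: mse_minimizer_lmmse => //.
    by move=> h [F [b [_ ->]]]; exists (V *m F *m V^T), b.
  (* This is a Wiener gain at each graph frequency: signal cross-covariance over output variance.
     The offset that follows matches the mean of the estimator with that of [x]. *)
  rewrite -E; exists (Dx *m Phi *m invmx D).
  exists (mean P x - V *m (Dx *m Phi *m invmx D) *m V^T *m mean P y).
  split.
    by apply: is_diag_mxM; [exact: is_diag_mxM|exact: is_diag_invmx].
  by apply/funext => z; rewrite /gsp_lmmse DE dE !mulmxA mulmxBr addrCA.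
Qed.
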